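(* Assume $\delta=d$, $\gamma\ge1$ and $\alpha\le0$ (including $\alpha=-\infty$). Then $G_z(w)=\lim_{n\to\infty}d^{-n}\log^+|Q_z^n(w)|$ exists (as a value in $[0,+\infty]$) on $A_p\times\mathbb{C}$; it equals $+\infty$ on $A_f$ and $0$ on $B_f$.
   Context: Let $p(z)=z^d+O(z^{d-1})$ be a monic polynomial of degree $\delta=d\ge 2$, and let $q(z,w)=b(z)w^d+(\text{terms of lower degree in } w)$ be a polynomial with $\deg_w q=d$, where $b$ is a monic polynomial of degree $\gamma$. Let $f(z,w)=(p(z),q(z,w))$. Write $Q_z^n=q_{p^{n-1}(z)}\circ\cdots\circ q_{p(z)}\circ q_z$ with $q_z=q(z,\cdot)$, so $f^n(z,w)=(p^n(z),Q_z^n(w))$. Let $A_p=\{z: p^n(z)\to\infty\}$. Define $\alpha=\max\{(n_j-\gamma)/(d-m_j)\}$ over monomials $z^{n_j}w^{m_j}$ appearing in $q$ with nonzero coefficient and $m_j<d$, and $\alpha=-\infty$ if $q=b(z)w^d$. Let $W_R=\{(z,w):|z|>R,\ |w|>R|z|^\alpha\}$ (if $\alpha=-\infty$: $\{|z|>R,\ w\ne0\}$), fix $R>1$ large enough that $f(W_R)\subset W_R$ and $W_R\subset A_p\times\mathbb{C}$, and set $A_f=\bigcup_{n\ge0}f^{-n}(W_R)$, $B_f=(A_p\times\mathbb{C})\setminus A_f$. *)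

(* Defs.v *)
From Stdlib Require Import Reals Lra List.
Open Scope R_scope.

Definition Cx : Type := (R * R)%type.
Definition Cx0 : Cx := (0, 0).
Definition Cx1 : Cx := (1, 0).
Definition Cadd (u v : Cx) : Cx := (fst u + fst v, snd u + snd v).
Definition Cmul (u v : Cx) : Cx :=
  (fst u * fst v - snd u * snd v, fst u * snd v + snd u * fst v).
Fixpoint Cpow (u : Cx) (n : nat) : Cx :=
  match n with O => Cx1 | S k => Cmul u (Cpow u k) end.
Definition Cnorm (u : Cx) : R := sqrt (fst u * fst u + snd u * snd u).

Definition Csum (n : nat) (F : nat -> Cx) : Cx :=
  fold_right (fun i acc => Cadd (F i) acc) Cx0 (seq 0 (S n)).

Definition poly1 (d : nat) (a : nat -> Cx) (z : Cx) : Cx :=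
  Csum d (fun i => Cmul (a i) (Cpow z i)).

Definition poly2 (N d : nat) (c : nat -> nat -> Cx) (z w : Cx) : Cx :=
  Csum d (fun j => Csum N (fun i => Cmul (c i j) (Cmul (Cpow z i) (Cpow w j)))).

Definition skew (p : Cx -> Cx) (q : Cx -> Cx -> Cx) (x : Cx * Cx) : Cx * Cx :=
  (p (fst x), q (fst x) (snd x)).

Fixpoint iterf {A : Type} (n : nat) (g : A -> A) (x : A) : A :=
  match n with O => x | S k => g (iterf k g x) end.

Definition logplus (x : R) : R := Rmax 0 (ln x).

(* alpha = max (n_j - gamma)/(d - m_j) over nonzero monomials with m_j < d;
   None encodes alpha = -infinity (no such monomial). *)
Definition ratio (gamma d i j : nat) : R := (INR i - INR gamma) / (INR d - INR j).

Definition is_alpha (d gamma : nat) (c : nat -> nat -> Cx) (alpha : option R) : Prop :=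
  match alpha with
  | None => forall i j, (j < d)%nat -> c i j = Cx0
  | Some x =>
      (exists i j, (j < d)%nat /\ c i j <> Cx0 /\ x = ratio gamma d i j) /\
      (forall i j, (j < d)%nat -> c i j <> Cx0 -> ratio gamma d i j <= x)
  end.

Definition alpha_le0 (alpha : option R) : Prop :=
  match alpha with None => True | Some x => x <= 0 end.

Definition W_set (alpha : option R) (Rr : R) (x : Cx * Cx) : Prop :=
  Rr < Cnorm (fst x) /\
  match alpha with
  | None => snd x <> Cx0
  | Some a => Rr * Rpower (Cnorm (fst x)) a < Cnorm (snd x)
  end.

Definition A_p (p : Cx -> Cx) (z : Cx) : Prop :=
  cv_infty (fun n => Cnorm (iterf n p z)).

(* Main.v *)
Require Import Defs.
From Stdlib Require Import Reals Lra Lia.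
From mathcomp Require all_boot all_order all_algebra complex Rstruct ring.
Open Scope R_scope.

(* On B_f the orbit eventually satisfies |w_n| <= R (as alpha <= 0), so G = 0.

   On A_f everything rests on |q(z,w)| >= c0 |z|^gamma |w|^d for (z,w) in W_R and
   |z| large: since log |z_n| grows like d^n, this gives
   X_(n+1) >= X_n + kappa for X_n = d^-n log |w_n|, up to a summable error.

   R is not assumed large enough to make this bound a direct estimate; it has to
   be extracted from the mere invariance of W_R.  Writing alpha = -m/k, z = s^-k
   and w = s^m/v, one has q(z,w) = z^gamma w^d H(s,v) with H a polynomial,
   H(0,0) = 1, and invariance says that H does not vanish for 0 < |s| < 1/R,
   0 < |v| < 1/R, with a quantitative bound on each slice s = s2.  A polynomial h
   of degree <= D without zeros in |x| < r satisfies
   |h(0)| (1 - |x|/r)^D <= |h(x)| <= 2^D |h(0)|, because each factor 1 - x/root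
   does.  On complex lines through the origin this shows H(0,v) <> 0 by letting
   s -> 0; then, in the variable s, it compares H(s,v) with H(s2,v) through
   H(0,v), which bounds |H(s,v)| below uniformly up to |v| = 1/R. *)

Module NonvanishingPolynomials.
Import all_boot all_order all_algebra mathcomp.algebra_tactics.ring.
Import Order.TTheory GRing.Theory Num.Theory.
Set Implicit Arguments.
Unset Strict Implicit.
Unset Printing Implicit Defensive.
Local Open Scope ring_scope.

(** * One-variable polynomials without zeros in a disc *)

Section Univariate.
Variable C : numClosedFieldType.
Implicit Types (p : {poly C}) (r x : C) (s : seq C).

(** The value at 0 excludes the zero polynomial, so over an algebraically closed field [p] splits
    with as many roots as its degree. *)
Lemma nonvanishing_roots p r : 0 < r -> (forall x, `|x| < r -> p.[x] != 0) ->
  exists2 s, (size s < size p)%N /\ p = lead_coef p *: \prod_(y <- s) ('X - y%:P) &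
    {in s, forall y, r <= `|y|}.
Proof.
move=> r0 nz; have [s def_p] := closed_field_poly_normal p; exists s.
  have pn0 : p != 0.
    by apply/eqP => p0; have := nz 0; rewrite normr0 p0 horner0 eqxx => /(_ r0).
  split=> //; rewrite {1}def_p size_scale ?lead_coef_eq0 //.
  by rewrite size_prod_XsubC.
move=> y ys; rewrite real_leNgt ?normr_real ?gtr0_real //; apply/negP => yr.
suff py : p.[y] = 0 by move: (nz _ yr); rewrite py eqxx.
have : root (\prod_(y <- s) ('X - y%:P)) y by rewrite root_prod_XsubC.
by rewrite def_p hornerZ => /rootP ->; rewrite mulr0.
Qed.

(** Factor by factor: |x - y| >= |y| - |x| >= |y| (1 - |x|/r), because r <= |y|. *)
Lemma norm_prod_root_lower s r x : 0 < r -> `|x| < r ->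
  {in s, forall y, r <= `|y|} ->
  `|\prod_(y <- s) (0 - y)| * (1 - `|x| / r) ^+ size s <= `|\prod_(y <- s) (x - y)|.
Proof.
move=> r0 xr; have t0 : 0 <= 1 - `|x| / r by rewrite subr_ge0 ler_pdivrMr // mul1r ltW.
elim: s => [|y s IHs] rs; first by rewrite !big_nil expr0 mulr1.
rewrite !big_cons !normrM exprS mulrACA ler_pM ?mulr_ge0 ?exprn_ge0 //; last first.
  by apply: IHs => z zs; apply: rs; rewrite inE zs orbT.
have ry : r <= `|y| by apply: rs; rewrite mem_head.
rewrite sub0r normrN distrC; apply: le_trans (lerB_dist _ _).
rewrite mulrBr mulr1 lerD2l lerN2 mulrC -mulrA ler_peMr //.
by rewrite mulrC ler_pdivlMr // mul1r.
Qed.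

Lemma norm_prod_root_upper s r x : 0 < r -> `|x| <= r ->
  {in s, forall y, r <= `|y|} ->
  `|\prod_(y <- s) (x - y)| <= `|\prod_(y <- s) (0 - y)| * 2 ^+ size s.
Proof.
move=> r0 xr; elim: s => [|y s IHs] rs; first by rewrite !big_nil expr0 mulr1.
rewrite !big_cons !normrM exprS mulrACA ler_pM //; last first.
  by apply: IHs => z zs; apply: rs; rewrite inE zs orbT.
have ry : r <= `|y| by apply: rs; rewrite mem_head.
rewrite sub0r normrN (le_trans (ler_normB _ _)) // mulr_natr mulr2n lerD2r.
exact: le_trans ry.
Qed.

(** A degree bound [D] replaces the number of roots; this only weakens the estimate, as the base
    lies in [0, 1], and keeps the constant uniform over families. *)
Lemma nonvanishing_lower p r D x : 0 < r -> (forall x, `|x| < r -> p.[x] != 0) ->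
  (size p <= D.+1)%N -> `|x| < r ->
  `|p.[0]| * (1 - `|x| / r) ^+ D <= `|p.[x]|.
Proof.
move=> r0 nz szp xr; have [s [szs def_p] rs] := nonvanishing_roots r0 nz.
rewrite def_p !hornerZ !horner_prod !normrM -mulrA ler_wpM2l //.
have hE u : \prod_(y <- s) ('X - y%:P).[u] = \prod_(y <- s) (u - y).
  by apply: eq_bigr => y _; rewrite hornerXsubC.
rewrite !hE; apply: le_trans (norm_prod_root_lower r0 xr rs).
rewrite ler_wpM2l // ler_wiXn2l //; last by rewrite -ltnS (leq_trans szs).
  by rewrite subr_ge0 ler_pdivrMr // mul1r ltW.
by rewrite lerBlDr lerDl divr_ge0 // ltW.
Qed.

Lemma nonvanishing_upper p r D x : 0 < r -> (forall x, `|x| < r -> p.[x] != 0) ->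
  (size p <= D.+1)%N -> `|x| <= r -> `|p.[x]| <= `|p.[0]| * 2 ^+ D.
Proof.
move=> r0 nz szp xr; have [s [szs def_p] rs] := nonvanishing_roots r0 nz.
rewrite def_p !hornerZ !horner_prod !normrM -mulrA ler_wpM2l //.
have hE u : \prod_(y <- s) ('X - y%:P).[u] = \prod_(y <- s) (u - y).
  by apply: eq_bigr => y _; rewrite hornerXsubC.
rewrite !hE; apply: le_trans (norm_prod_root_upper r0 xr rs) _.
rewrite ler_wpM2l // ler_weXn2l ?ler1n //.
by rewrite -ltnS (leq_trans szs).
Qed.

Lemma size_sum_scaleXn (I : finType) (a : I -> C) (n : I -> nat) D :
  (forall i, (n i <= D)%N) -> (size (\sum_i a i *: 'X^(n i))%R <= D.+1)%N.
Proof.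
move=> nD; apply: leq_trans (size_sum _ _ _) _; apply/bigmax_leqP => i _.
by apply: leq_trans (size_scale_leq _ _) _; rewrite size_polyXn ltnS.
Qed.

Lemma horner_sum_scaleXn (I : finType) (a : I -> C) (n : I -> nat) x :
  (\sum_i a i *: 'X^(n i)).[x] = \sum_i a i * x ^+ n i.
Proof.
by rewrite horner_sum; apply: eq_bigr => i _; rewrite hornerZ hornerXn.
Qed.

End Univariate.

Lemma one_sub_half (F : numFieldType) : 1 - 2^-1 = 2^-1 :> F.
Proof. by rewrite [X in X - _](splitr 1) div1r addrK. Qed.

(** * Two-variable polynomials without zeros on a punctured bidisc *)

Section Bivariate.
Variables (C : numClosedFieldType) (I : finType) (c : I -> C) (e g : I -> nat).

(** General exponent maps let this serve both as the weighted homogenization of [q] and, with [g]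
    zero, as a one-variable polynomial read at infinity. *)
Definition bipoly (s v : C) := \sum_i c i * s ^+ e i * v ^+ g i.

Definition coef_mass := \sum_i `|c i|.

Lemma coef_mass_ge0 : 0 <= coef_mass. Proof. exact: sumr_ge0. Qed.

Lemma bipoly_near0 s v (eta : C) : eta <= 1 -> `|s| <= eta -> `|v| <= eta ->
  `|bipoly s v - bipoly 0 0| <= coef_mass * eta.
Proof.
move=> eta1 seta veta; have eta0 : 0 <= eta by apply: le_trans seta.
rewrite /bipoly -sumrB mulr_suml.
apply: le_trans (ler_norm_sum _ _ _) _; apply: ler_sum => i _.
rewrite -!mulrA -mulrBr normrM ler_wpM2l //.
have le1 (x : C) n : `|x| <= eta -> `|x ^+ n| <= 1.
  by move=> xeta; rewrite normrX exprn_ile1 // (le_trans xeta).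
case: (e i) => [|n].
  case: (g i) => [|m]; first by rewrite !expr0 subrr normr0.
  rewrite !expr0 !mul1r [0 ^+ _]exprS mul0r subr0 exprS normrM -[leRHS]mulr1.
  by rewrite ler_pM // le1.
rewrite [0 ^+ _]exprS !mul0r subr0 exprS !normrM -[leRHS]mulr1 -mulrA.
by rewrite ler_pM ?mulr_ge0 // mulr_ile1 // le1.
Qed.

Lemma bipoly_large_near0 : bipoly 0 0 = 1 ->
  exists2 eta : C, 0 < eta & forall s v, `|s| <= eta -> `|v| <= eta ->
    2^-1 <= `|bipoly s v|.
Proof.
move=> h0; have A0 := coef_mass_ge0.
have A1 : 0 < coef_mass + 1 by rewrite ltr_wpDl.
(* The summand 1 avoids a division by zero and keeps the witness at most 1. *)
exists (2^-1 / (coef_mass + 1)); first by rewrite divr_gt0 ?invr_gt0 ?ltr0n.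
move=> s v sle vle; rewrite -[bipoly s v](subrK 1) addrC -h0.
have lt1: 2^-1 / (coef_mass + 1) <= 1.
  rewrite ler_pdivrMr // mul1r (@le_trans _ _ 1) ?invf_le1 ?ler1n ?ltr0n //.
  by rewrite lerDr.
have := bipoly_near0 lt1 sle vle; rewrite h0 => near1.
apply: le_trans (lerB_normD _ _); rewrite normr1 lerBrDr -lerBrDl.
apply: le_trans near1 _; rewrite one_sub_half.
rewrite mulrCA -[leRHS]mulr1 ler_wpM2l ?invr_ge0 ?ler0n //.
by rewrite ler_pdivrMr // mul1r lerDl.
Qed.

Hypothesis bipoly00 : bipoly 0 0 = 1.
Variables (r rho : C).
Hypotheses (r0 : 0 < r) (rho0 : 0 < rho).
Hypothesis nonvanishing : forall s v, 0 < `|s| -> `|s| < r ->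
  0 < `|v| -> `|v| < rho -> bipoly s v != 0.

(** The total degree bounds the degree on lines through the origin and on slices in [s] alike. *)
Let D := \max_i (e i + g i).
Let leD i : (e i + g i <= D)%N. Proof. exact: leq_bigmax. Qed.

(* The complex line through the origin and (s, v) stays inside the region of
   nonvanishing, up to the origin itself where the value is 1. *)
Lemma bipoly_line_lower s v : 0 < `|v| -> `|v| < rho -> 0 < `|s| ->
  `|s| < r * (`|v| / rho) -> (1 - `|v| / rho) ^+ D <= `|bipoly s v|.
Proof.
move=> v0 vr s0 sr.
pose p : {poly C} := \sum_i (c i * s ^+ e i * v ^+ g i) *: 'X^(e i + g i).
have pE x : p.[x] = bipoly (x * s) (x * v).
  rewrite /p horner_sum_scaleXn; apply: eq_bigr => i _.
  by rewrite !exprMn exprD; ring.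
have nz x : `|x| < rho / `|v| -> p.[x] != 0.
  move=> xr; have [->|x0] := eqVneq x 0.
    by rewrite pE !mul0r bipoly00 oner_neq0.
  rewrite pE; have nx0 : 0 < `|x| by rewrite normr_gt0.
  apply: nonvanishing; rewrite normrM ?mulr_gt0 //; last by rewrite -ltr_pdivlMr.
  apply: (@lt_trans _ _ (rho / `|v| * `|s|)); first by rewrite ltr_pM2r.
  by rewrite -ltr_pdivlMl ?divr_gt0 // invf_div mulrC.
have szp : (size p <= D.+1)%N by apply: size_sum_scaleXn.
have vr0 : 0 < rho / `|v| by rewrite divr_gt0.
have x1 : `|1 : C| < rho / `|v| by rewrite normr1 ltr_pdivlMr // mul1r.
have := nonvanishing_lower vr0 nz szp x1.
by rewrite !pE !mul0r bipoly00 !mul1r normr1 mul1r invf_div mul1r.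
Qed.

Lemma pos_lower_bound (x y : C) : 0 < x -> 0 < y ->
  exists z : C, [/\ 0 < z, z <= x & z <= y].
Proof.
move=> x0 y0; have [xy|yx] := real_leP (gtr0_real x0) (gtr0_real y0).
  by exists x.
by exists y; split=> //; apply: ltW.
Qed.

(** The bound of [bipoly_line_lower] does not depend on [s], whereas a zero at (0, v) would make the
    values at (s, v) of order |s|. *)
Lemma bipoly_axis_neq0 v : 0 < `|v| -> `|v| < rho -> bipoly 0 v != 0.
Proof.
move=> v0 vr; apply/eqP => h0.
have k0 : 0 < (1 - `|v| / rho) ^+ D.
  by rewrite exprn_gt0 // subr_gt0 ltr_pdivrMr // mul1r.
pose B := \sum_i `|c i| * `|v| ^+ g i.
have B0 : 0 <= B by apply: sumr_ge0 => i _; rewrite mulr_ge0 ?exprn_ge0.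
have B1 : 0 < B + 1 by rewrite ltr_wpDl.
have near s : `|s| <= 1 -> `|bipoly s v| <= B * `|s|.
  move=> s1; rewrite -[bipoly s v]subr0 -h0 /bipoly -sumrB mulr_suml.
  apply: le_trans (ler_norm_sum _ _ _) _; apply: ler_sum => i _.
  rewrite -mulrBl -mulrBr !normrM mulrAC normrX ler_wpM2l ?mulr_ge0 ?exprn_ge0 //.
  case: (e i) => [|n]; first by rewrite !expr0 subrr normr0.
  rewrite [0 ^+ _]exprS mul0r subr0 exprS normrM ler_piMr // normrX.
  by rewrite exprn_ile1.
have t0 : 0 < r * (`|v| / rho) by rewrite mulr_gt0 ?divr_gt0.
(* [u] keeps |s| within 1 and within the range of the line bound; [w] makes [B * |s|] too small.
   Halving makes the inequalities strict. *)
have [u [u0 u1 u2]] := pos_lower_bound ltr01 t0.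
have [w [w0 w1 w2]] := pos_lower_bound u0 (divr_gt0 k0 B1).
have w20 : 0 < w / 2 by rewrite divr_gt0 ?ltr0n.
have wlt : w / 2 < w by rewrite ltr_pdivrMr ?ltr0n // ltr_pMr // ltr1n.
have nw : `|w / 2| = w / 2 by rewrite gtr0_norm.
have lo : (1 - `|v| / rho) ^+ D <= `|bipoly (w / 2) v|.
  apply: bipoly_line_lower; rewrite ?nw //.
  by apply: lt_le_trans wlt _; apply: le_trans u2.
have hi : `|bipoly (w / 2) v| <= B * (w / 2).
  by rewrite -{2}nw near // nw ltW // (lt_le_trans wlt) // (le_trans w1).
have : B * (w / 2) < (1 - `|v| / rho) ^+ D.
  apply: (@le_lt_trans _ _ ((B + 1) * (w / 2))).
    by rewrite ler_wpM2r ?lerDl // ltW.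
  by rewrite mulrC -ltr_pdivlMr // (lt_le_trans wlt).
by move=> /(le_lt_trans hi) /(le_lt_trans lo); rewrite ltxx.
Qed.

(* Harnack: both values are comparable, up to 2 ^+ D, with the value at s = 0. *)
Lemma bipoly_slice_compare s2 s v : 0 < `|v| -> `|v| < rho ->
  `|s2| < r -> `|s| <= r / 2 ->
  `|bipoly s2 v| * (2 ^-1) ^+ D * (2 ^-1) ^+ D <= `|bipoly s v|.
Proof.
move=> v0 vr s2r sr.
pose p : {poly C} := \sum_i (c i * v ^+ g i) *: 'X^(e i).
have pE x : p.[x] = bipoly x v.
  by rewrite /p horner_sum_scaleXn; apply: eq_bigr => i _; rewrite mulrAC.
have nz x : `|x| < r -> p.[x] != 0.
  move=> xr; rewrite pE; have [->|x0] := eqVneq x 0; first exact: bipoly_axis_neq0.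
  by apply: nonvanishing; rewrite ?normr_gt0 // -normr_gt0.
have szp : (size p <= D.+1)%N.
  by apply: size_sum_scaleXn => i; apply: leq_trans (leD i); apply: leq_addr.
have h2 : 2^-1 <= 1 - `|s| / r.
  rewrite lerBrDr -lerBrDl ler_pdivrMr // (le_trans sr) // mulrC.
  by rewrite one_sub_half mulrC.
have sltr : `|s| < r.
  by apply: le_lt_trans sr _; rewrite ltr_pdivrMr ?ltr0n // ltr_pMr // ltr1n.
(* Passing from 0 to [s] costs one factor 2^-D, since |s| <= r/2; passing from [s2] to 0 costs the
   other. *)
have lo := nonvanishing_lower r0 nz szp sltr.
have hi := nonvanishing_upper r0 nz szp (ltW s2r).
rewrite -!pE; apply: le_trans lo; apply: ler_pM; rewrite ?mulr_ge0 ?exprn_ge0 ?invr_ge0 ?ler0n //.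
  by rewrite exprVn ler_pdivrMr ?exprn_gt0 ?ltr0n.
by rewrite lerXn2r ?nnegrE ?invr_ge0 ?ler0n // (le_trans _ h2) // invr_ge0 ler0n.
Qed.

(** The assumed bound degenerates only as v tends to 0. For |v| <= eta the value 1 at the origin
    takes over; beyond, the bound is at least m eta^d and is carried from [s2] to [s] by
    [bipoly_slice_compare]. *)
Lemma bipoly_uniform_lower s2 (m : C) d : 0 < m -> `|s2| < r ->
  (forall v, 0 < `|v| -> `|v| < rho -> m * `|v| ^+ d <= `|bipoly s2 v|) ->
  exists k : C, exists2 t : C, 0 < k /\ 0 < t &
    forall s v, `|s| <= t -> 0 < `|v| -> `|v| < rho -> k <= `|bipoly s v|.
Proof.
move=> m0 s2r lo; have [eta eta0 near] := bipoly_large_near0 bipoly00.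
have half0 : 0 < 2^-1 :> C by rewrite invr_gt0 ltr0n.
pose k2 := m * eta ^+ d * (2 ^-1) ^+ D * (2 ^-1) ^+ D.
have k20 : 0 < k2 by rewrite !mulr_gt0 ?exprn_gt0.
have [k [k0 kle1 kle2]] := pos_lower_bound half0 k20.
have [t [t0 t1 t2]] := pos_lower_bound eta0 (divr_gt0 r0 (ltr0n C 2)).
exists k, t => // s v st v0 vr.
have [veta|etav] := real_leP (normr_real v) (gtr0_real eta0).
  by apply: le_trans kle1 _; apply: near => //; apply: le_trans t1.
apply: le_trans kle2 _.
apply: le_trans (bipoly_slice_compare v0 vr s2r (le_trans st t2)).
do 2!rewrite ler_wpM2r ?exprn_ge0 ?(ltW half0) //.
apply: le_trans (lo v v0 vr); rewrite ler_wpM2l ?(ltW m0) //.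
by rewrite lerXn2r ?nnegrE ?(ltW eta0) // ltW.
Qed.

End Bivariate.

(* With [z = s ^- k] and [w = s ^+ m / v], where [alpha = - m / k], the leading
   monomial [z ^+ gamma * w ^+ d] factors out of [q] and leaves a polynomial in
   [(s, v)]; the region [W_R] becomes the punctured bidisc. *)
Section WeightedHomogenization.
Variables (C : numClosedFieldType) (d N gamma k m : nat) (c : nat -> nat -> C).
Hypotheses (k0 : (0 < k)%N) (gammaN : (gamma <= N)%N) (c_lead : c gamma d = 1).
Hypothesis c_weight : forall i j, (j <= d)%N -> c i j != 0 ->
  (k * i + m * (d - j) <= k * gamma)%N.

Let I : finType := ('I_d.+1 * 'I_N.+1)%type.
Let cI (p : I) := c p.2 p.1.
(** By [c_weight] the truncated subtractions are exact wherever the coefficient is nonzero. *)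
Let eI (p : I) := (k * gamma - k * p.2 - m * (d - p.1))%N.
Let gI (p : I) := (d - p.1)%N.

Definition bieval (z w : C) :=
  \sum_(j < d.+1) \sum_(i < N.+1) c i j * (z ^+ i * w ^+ j).

(** Monomials with j < d keep a factor v, those with j = d and i < gamma a factor s; [c_weight]
    excludes j = d with i > gamma. *)
Lemma homogenization00 : bipoly cI eI gI 0 0 = 1.
Proof.
pose p0 : I := (inord d, inord gamma).
rewrite /bipoly (bigD1 p0) //= big1 => [|[j i] pn].
  by rewrite /cI /eI /gI /p0 /= !inordK ?ltnS // !subnn muln0 subn0 !expr0 !mulr1 addr0.
rewrite /cI /eI /gI /=; have [->|cn] := eqVneq (c i j) 0; first by rewrite !mul0r.
have jd : (j <= d)%N by rewrite -ltnS.
have := c_weight jd cn; case: (ltnP j d) => [jltd|dlej] le_w.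
  by rewrite [X in _ * X]expr0n subn_eq0 leqNgt jltd mulr0.
have ej : j = d :> nat by apply/eqP; rewrite eqn_leq jd.
have ig : (i < gamma)%N.
  move: le_w; rewrite ej subnn muln0 addn0 leq_pmul2l // leq_eqVlt => /orP[/eqP ig|//].
  case/negP: pn; apply/eqP; congr pair; apply: val_inj; rewrite /= inordK //.
rewrite ej subnn muln0 subn0 [X in _ * X * _]expr0n subn_eq0 leq_pmul2l // leqNgt ig.
by rewrite mulr0 mul0r.
Qed.

Lemma homogenizationE s w : s != 0 -> w != 0 ->
  bieval (s ^- k) w = s ^- (k * gamma) * w ^+ d * bipoly cI eI gI s (s ^+ m / w).
Proof.
move=> s0 w0; rewrite /bieval /bipoly pair_bigA /= mulr_sumr.
apply: eq_bigr => -[j i] _; rewrite /cI /eI /gI /=.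
have [->|cn] := eqVneq (c i j) 0; first by rewrite !mul0r mulr0.
have jd : (j <= d)%N by rewrite -ltnS.
have le_w := c_weight jd cn.
have kgE : (k * gamma = (k * gamma - k * i - m * (d - j)) + k * i + m * (d - j))%N.
  by rewrite -addnA -subnDA subnK.
set E := (k * gamma - k * i - m * (d - j))%N in kgE *.
rewrite kgE; set b := (d - j)%N.
have -> : w ^+ d = w ^+ b * w ^+ j by rewrite -exprD subnK.
rewrite !exprD expr_div_n exprVn -!exprM.
have sE n : s ^+ n != 0 by rewrite expf_neq0.
have wE n : w ^+ n != 0 by rewrite expf_neq0.
by field; rewrite !sE wE.
Qed.

Variable R : C.
Hypothesis R1 : 1 < R.
Hypothesis slice_lower : forall s : C, s != 0 -> R * `|s| ^+ k < 1 ->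
  exists2 mu : C, 0 < mu &
    forall w, R * `|s| ^+ m < `|w| -> mu <= `|bieval (s ^- k) w|.

(** In [slice_lower] the bound [mu] may depend on [s] in any way. Its positivity gives nonvanishing
    on the punctured bidisc of radii [R^-1]; its size is used on the single slice [s2]. *)
Lemma bieval_lower : exists c0 : C, exists2 t : C, 0 < c0 /\ 0 < t &
  forall s w : C, s != 0 -> `|s| <= t -> R * `|s| ^+ m < `|w| ->
    c0 * `|s ^- k| ^+ gamma * `|w| ^+ d <= `|bieval (s ^- k) w|.
Proof.
have R0 : 0 < R by apply: lt_trans R1.
have iR0 : 0 < R^-1 by rewrite invr_gt0.
(* Since |s| < 1 and k >= 1, the disc |s| < 1/R lies within the range |z| > R. *)
have small (s : C) : `|s| < R^-1 -> R * `|s| ^+ k < 1.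
  move=> sR; have s1 : `|s| < 1 by rewrite (lt_trans sR) // invf_lt1.
  rewrite mulrC -ltr_pdivlMr // mul1r; apply: le_lt_trans sR.
  by rewrite -(prednK k0) exprS ler_piMr // exprn_ile1 // ltW.
have wOf (s v : C) : s != 0 -> 0 < `|v| -> `|v| < R^-1 ->
    [/\ R * `|s| ^+ m < `|s ^+ m / v|, s ^+ m / v != 0 & s ^+ m / (s ^+ m / v) = v].
  move=> s0 v0 vR; have sm0 : s ^+ m != 0 by rewrite expf_neq0.
  have vn0 : v != 0 by rewrite -normr_gt0.
  split; last by rewrite invf_div mulrA [s ^+ m * v]mulrC mulfK.
    rewrite normrM normfV normrX mulrC ltr_pM2l ?exprn_gt0 ?normr_gt0 //.
    by rewrite -[R]invrK ltf_pV2.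
  by rewrite mulf_neq0 // invr_neq0.
have nz (s v : C) : 0 < `|s| -> `|s| < R^-1 -> 0 < `|v| -> `|v| < R^-1 ->
    bipoly cI eI gI s v != 0.
  rewrite normr_gt0 => s0 sR v0 vR; have [mu mu0 lo] := slice_lower s0 (small _ sR).
  have [wR wn0 vE] := wOf s v s0 v0 vR.
  have := lt_le_trans mu0 (lo _ wR); rewrite normr_gt0 homogenizationE // vE.
  by rewrite mulf_eq0 negb_or => /andP[].
have [s2 s20 s2R] : exists2 s2 : C, s2 != 0 & `|s2| < R^-1.
  exists (R^-1 / 2); first by rewrite gt_eqF // divr_gt0 ?ltr0n.
  by rewrite gtr0_norm ?divr_gt0 ?ltr0n // ltr_pdivrMr ?ltr0n // ltr_pMr // ltr1n.
have [mu mu0 lo] := slice_lower s20 (small _ s2R).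
pose A := `|s2| ^+ (k * gamma); pose B := `|s2| ^+ (m * d).
have A0 : 0 < A by rewrite exprn_gt0 ?normr_gt0.
have B0 : 0 < B by rewrite exprn_gt0 ?normr_gt0.
(* With |w| = |s2|^m / |v|, the leading monomial has modulus [A^-1 * (B / V)], where V = |v|^d;
   dividing by it turns [mu] into a multiple of |v|^d. *)
have lo2 v : 0 < `|v| -> `|v| < R^-1 ->
    mu * A / B * `|v| ^+ d <= `|bipoly cI eI gI s2 v|.
  move=> v0 vR; have [wR wn0 vE] := wOf s2 v s20 v0 vR.
  have := lo _ wR; rewrite homogenizationE // vE !normrM normfV !normrX normrM normfV.
  rewrite normrX -/A expr_div_n -exprM -/B => h.
  have V0 : 0 < `|v| ^+ d by rewrite exprn_gt0.
  set V := `|v| ^+ d in h V0 *.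
  set X := `|bipoly _ _ _ _ _| in h *.
  have -> : X = A^-1 * (B / V) * X * (A * (V / B)).
    by field; rewrite !gt_eqF.
  have -> : mu * A / B * V = mu * (A * (V / B)) by field; rewrite gt_eqF.
  by rewrite ler_wpM2r // ltW // mulr_gt0 // divr_gt0.
have mAB : 0 < mu * A / B by rewrite divr_gt0 // mulr_gt0.
have [c0 [t [c00 t0] H]] := bipoly_uniform_lower homogenization00 iR0 iR0 nz mAB s2R lo2.
exists c0, t => // s w s0 st sw.
have w0 : 0 < `|w| by apply: le_lt_trans sw; rewrite mulr_ge0 ?exprn_ge0 // ltW.
have wn0 : w != 0 by rewrite -normr_gt0.
have vR : `|s ^+ m / w| < R^-1.
  by rewrite normrM normfV normrX ltr_pdivrMr // mulrC ltr_pdivlMr // mulrC.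
have v0 : 0 < `|s ^+ m / w| by rewrite normr_gt0 mulf_neq0 ?invr_neq0 ?expf_neq0.
have -> : `|s ^- k| ^+ gamma = `|s ^- (k * gamma)| by rewrite -normrX exprVn -exprM.
rewrite homogenizationE // !normrM normrX -mulrA mulrC.
by rewrite ler_wpM2l ?mulr_ge0 ?exprn_ge0 // H.
Qed.

End WeightedHomogenization.

End NonvanishingPolynomials.

(** * Arithmetic of the exponents defining alpha *)

(** With k = d - j0 and m = gamma - i0, clearing denominators in the maximality of alpha = -m/k
    gives the case j < d of [c_weight]. *)
Lemma ratio_weight (gamma d i0 j0 i j : nat) :
  (j0 < d)%nat -> (j < d)%nat -> (i0 <= gamma)%nat ->
  ratio gamma d i j <= ratio gamma d i0 j0 ->
  ((d - j0) * i + (gamma - i0) * (d - j) <= (d - j0) * gamma)%nat.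
Proof.
intros Hj0 Hj Hi0 H.
apply INR_le. rewrite plus_INR, !mult_INR, !minus_INR by lia.
assert (A0 : 0 < INR d - INR j0) by (apply lt_INR in Hj0; lra).
assert (A : 0 < INR d - INR j) by (apply lt_INR in Hj; lra).
unfold ratio in H.
set (x := INR d - INR j0) in *. set (y := INR d - INR j) in *.
set (u := INR i) in *. set (u0 := INR i0) in *. set (g := INR gamma) in *.
apply (Rmult_le_compat_r (x * y)) in H; [|nra].
replace ((u - g) / y * (x * y)) with ((u - g) * x) in H by (field; lra).
replace ((u0 - g) / x * (x * y)) with ((u0 - g) * y) in H by (field; lra).
nra.
Qed.

Lemma ratio_nonpos (gamma d i0 j0 : nat) :
  (j0 < d)%nat -> ratio gamma d i0 j0 <= 0 -> (i0 <= gamma)%nat.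
Proof.
intros Hj0 H. apply INR_le.
assert (A0 : 0 < INR d - INR j0) by (apply lt_INR in Hj0; lra).
unfold ratio in H.
apply (Rmult_le_compat_r (INR d - INR j0)) in H; [|lra].
replace ((INR i0 - INR gamma) / (INR d - INR j0) * (INR d - INR j0))
  with (INR i0 - INR gamma) in H by (field; lra).
lra.
Qed.

(** For |z| = x^-k the real power |z|^alpha becomes the natural power x^m, so the boundary of W_R is
    monomial in |s|. *)
Lemma Rpower_inv_pow_ratio (gamma d i0 j0 : nat) (x : R) :
  0 < x -> (j0 < d)%nat -> (i0 <= gamma)%nat ->
  Rpower (/ x ^ (d - j0)) (ratio gamma d i0 j0) = x ^ (gamma - i0).
Proof.
intros Hx Hj0 Hi0. rewrite <- (Rpower_pow (gamma - i0)) by assumption.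
unfold Rpower. f_equal.
rewrite ln_Rinv, ln_pow, !minus_INR by (try apply pow_lt; lia || assumption).
unfold ratio. assert (A0 : 0 < INR d - INR j0) by (apply lt_INR in Hj0; lra).
field. lra.
Qed.

(** * Transfer between pairs of reals and the algebraically closed field [R[i]] *)

Module ComplexNorms.
Import all_boot all_order all_algebra complex Rstruct mathcomp.algebra_tactics.ring.
Import Order.TTheory GRing.Theory Num.Theory.
Import NonvanishingPolynomials.
Set Implicit Arguments.
Unset Strict Implicit.
Unset Printing Implicit Defensive.
Local Open Scope complex_scope.
Local Open Scope ring_scope.

Definition toC (u : Cx) : R[i] := u.1 +i* u.2.
Definition ofC (z : R[i]) : Cx := (complex.Re z, complex.Im z).

Lemma toCK : cancel toC ofC. Proof. by case. Qed.
Lemma ofCK : cancel ofC toC. Proof. by case. Qed.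

Lemma toC0 : toC Cx0 = 0. Proof. by []. Qed.
Lemma toC1 : toC Cx1 = 1. Proof. by []. Qed.
Lemma toCM u v : toC (Cmul u v) = toC u * toC v.
Proof. by []. Qed.

Lemma toCX u n : toC (Cpow u n) = toC u ^+ n.
Proof. by elim: n => [|n IHn] //; rewrite exprS -IHn -toCM. Qed.

Lemma toC_eq0 u : (toC u == 0) = (u == Cx0).
Proof. by rewrite -toC0 (can_eq toCK). Qed.

Lemma toC_sum n F : toC (Csum n F) = \sum_(i < n.+1) toC (F i).
Proof.
rewrite -(big_mkord xpredT (fun i => toC (F i))) /Csum.
have -> : List.seq 0 n.+1 = index_iota 0 n.+1.
  rewrite /index_iota subn0; elim: n.+1 0%N => //= k IHk m; by rewrite IHk.
elim: (index_iota 0 n.+1) => [|i s IHs]; first by rewrite big_nil.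
by rewrite big_cons -IHs.
Qed.

Lemma norm_toC u : `|toC u| = (Cnorm u)%:C.
Proof. by rewrite normc_def /= /Cnorm RsqrtE. Qed.

Lemma real_complex_pow (x : R) n : (pow x n)%:C = x%:C ^+ n.
Proof. by rewrite RpowE rmorphXn. Qed.

Lemma real_complex_le (x y : R) : (x%:C <= y%:C) <-> Rle x y.
Proof. by rewrite lecR; split=> /RleP. Qed.

Lemma real_complex_lt (x y : R) : (x%:C < y%:C) <-> Rlt x y.
Proof. by rewrite ltcR; split=> /RltP. Qed.

(** The order of [R[i]] compares only numbers with equal imaginary parts, so positive constants
    found there are real. *)
Lemma gt0_real_complex (z : R[i]) : 0 < z -> exists2 x : R, Rlt 0 x & z = x%:C.
Proof.
case: z => a b; rewrite ltcE /= => /andP[/eqP -> /RltP a0].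
by exists a.
Qed.

Lemma Cnorm_ge0 u : Rle 0 (Cnorm u). Proof. exact: sqrt_pos. Qed.

Lemma Cnorm_gt0 u : u <> Cx0 -> Rlt 0 (Cnorm u).
Proof.
move=> un0; apply/real_complex_lt; rewrite -norm_toC normr_gt0 toC_eq0.
exact/eqP.
Qed.

Lemma CnormM u v : Cnorm (Cmul u v) = Rmult (Cnorm u) (Cnorm v).
Proof. by apply: complexI; rewrite -norm_toC toCM normrM !norm_toC rmorphM. Qed.

Lemma CnormX u n : Cnorm (Cpow u n) = pow (Cnorm u) n.
Proof. by apply: complexI; rewrite -norm_toC toCX normrX norm_toC real_complex_pow. Qed.

Lemma Cnorm_inv u v : toC v = (toC u)^-1 -> Cnorm v = Rinv (Cnorm u).
Proof.
by move=> vE; apply: complexI; rewrite -norm_toC vE normfV norm_toC RinvE fmorphV.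
Qed.

Lemma toC_poly1 D a z : toC (poly1 D a z) = \sum_(i < D.+1) toC (a i) * toC z ^+ i.
Proof. by rewrite toC_sum; apply: eq_bigr => i _; rewrite toCM toCX. Qed.

Lemma toC_poly2 N d c z w :
  toC (poly2 N d c z w) = bieval d N (fun i j => toC (c i j)) (toC z) (toC w).
Proof.
rewrite toC_sum; apply: eq_bigr => j _; rewrite toC_sum; apply: eq_bigr => i _.
by rewrite !toCM !toCX.
Qed.

Lemma poly2_top N d c z w :
  (forall i j, (j < d)%coq_nat -> c i j = Cx0) ->
  poly2 N d c z w = Cmul (poly1 N (fun i => c i d) z) (Cpow w d).
Proof.
move=> c0; apply: (can_inj toCK); rewrite toCM toCX toC_poly2 toC_poly1 /bieval.
rewrite big_ord_recr /= big1 => [|j _].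
  by rewrite add0r mulr_suml; apply: eq_bigr => i _; rewrite mulrA.
by apply: big1 => i _; rewrite c0 ?toC0 ?mul0r //; apply/ssrnat.ltP.
Qed.

(** Dividing by z^n and substituting 1/z leaves a [bipoly] with value 1 at the origin. This serves
    both [p] and the leading coefficient b of [q]. *)
Lemma monic_poly1_lower D n a : (n <= D)%coq_nat -> a n = Cx1 ->
  (forall i, (n < i)%coq_nat -> a i = Cx0) ->
  exists2 R1 : R, Rlt 0 R1 & forall z, Rle R1 (Cnorm z) ->
    Rle (Rmult (Rinv (IZR 2)) (pow (Cnorm z) n)) (Cnorm (poly1 D a z)).
Proof.
move=> /ssrnat.leP nD an a0.
pose cA (i : 'I_D.+1) := toC (a i).
pose eA (i : 'I_D.+1) := (n - i)%N; pose gA (i : 'I_D.+1) := 0%N.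
have b00 : bipoly cA eA gA 0 0 = 1.
  rewrite /bipoly (bigD1 (inord n)) //= big1 => [|i ni].
    by rewrite /cA /eA /gA inordK ?ltnS // an toC1 subnn !expr0 !mulr1 addr0.
  rewrite /cA /eA /gA; case: (ltngtP n i) => [/ssrnat.ltP /a0 -> | ltin | eqin].
  - by rewrite toC0 !mul0r.
  - by rewrite [X in _ * X * _]expr0n subn_eq0 leqNgt ltin mulr0 mul0r.
  by case/eqP: ni; apply: val_inj; rewrite /= inordK ?ltnS.
have [eta /gt0_real_complex [x x0 ->] near] := bipoly_large_near0 b00.
exists (Rinv x) => [|z xz]; first exact: Rinv_0_lt_compat.
have nz0 : Rlt 0 (Cnorm z) by apply: Rlt_le_trans xz; apply: Rinv_0_lt_compat.
have z0 : toC z != 0 by rewrite -normr_gt0 norm_toC; apply/real_complex_lt.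
have pE : toC (poly1 D a z) = toC z ^+ n * bipoly cA eA gA (toC z)^-1 0.
  rewrite toC_poly1 /bipoly mulr_sumr; apply: eq_bigr => i _.
  rewrite /cA /eA /gA expr0 mulr1; case: (leqP i n) => [lein | /ssrnat.ltP /a0 ->].
    have -> : toC z ^+ n = toC z ^+ (n - i) * toC z ^+ i by rewrite -exprD subnK.
    rewrite exprVn; have h : toC z ^+ (n - i) != 0 by rewrite expf_neq0.
    by field.
  by rewrite toC0 !mul0r mulr0.
apply/real_complex_le; rewrite -norm_toC pE.
have -> : (Rmult (Rinv (IZR 2)) (pow (Cnorm z) n))%:C = 2^-1 * `|toC z| ^+ n.
  rewrite norm_toC -real_complex_pow RmultE rmorphM RinvE fmorphV; congr (_^-1 * _).
  by rewrite -[2]/(1 + 1) -(rmorph1 (real_complex R)) -rmorphD.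
rewrite normrM normrX mulrC ler_wpM2l ?exprn_ge0 //.
apply: near; rewrite ?normr0; last by apply: ltW; apply/real_complex_lt.
rewrite normfV norm_toC -fmorphV; apply/real_complex_le.
by rewrite -(Rinv_inv x); apply: Rinv_le_contravar => //; apply: Rinv_0_lt_compat.
Qed.

(** Real-valued form of [bieval_lower], the ratio of (i0, j0) being alpha: a bound [mu] varying with
    [z] is upgraded to a uniform one. *)
Lemma poly2_lower (d N gamma i0 j0 : nat) (c : nat -> nat -> Cx) (Rr : R) :
  (j0 < d)%coq_nat -> (gamma <= N)%coq_nat -> c gamma d = Cx1 ->
  (forall i, (gamma < i)%coq_nat -> c i d = Cx0) ->
  Rle (Defs.ratio gamma d i0 j0) 0 ->
  (forall i j, (j < d)%coq_nat -> c i j <> Cx0 ->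
    Rle (Defs.ratio gamma d i j) (Defs.ratio gamma d i0 j0)) ->
  Rlt 1 Rr ->
  (forall z, Rlt Rr (Cnorm z) -> exists2 mu : R, Rlt 0 mu & forall w,
    Rlt (Rmult Rr (Rpower (Cnorm z) (Defs.ratio gamma d i0 j0))) (Cnorm w) ->
    Rle mu (Cnorm (poly2 N d c z w))) ->
  exists c0 : R, exists2 R1 : R, Rlt 0 c0 /\ Rlt 0 R1 & forall z w,
    Rle R1 (Cnorm z) ->
    Rlt (Rmult Rr (Rpower (Cnorm z) (Defs.ratio gamma d i0 j0))) (Cnorm w) ->
    Rle (Rmult (Rmult c0 (pow (Cnorm z) gamma)) (pow (Cnorm w) d))
        (Cnorm (poly2 N d c z w)).
Proof.
move=> j0d gammaN c1 cdeg al0 al_max Rr1 slice.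
have i0g : (i0 <= gamma)%coq_nat := ratio_nonpos _ _ _ _ j0d al0.
pose k := (d - j0)%N; pose m := (gamma - i0)%N.
have k0 : (0 < k)%N by rewrite subn_gt0; apply/ssrnat.ltP.
pose cC i j := toC (c i j).
have weight i j : (j <= d)%N -> cC i j != 0 -> (k * i + m * (d - j) <= k * gamma)%N.
  rewrite leq_eqVlt toC_eq0 => /orP[/eqP -> | /ssrnat.ltP jd] /eqP cn.
    rewrite subnn muln0 addn0 leq_pmul2l // leqNgt; apply/negP => /ssrnat.ltP ig.
    by apply: cn; apply: cdeg.
  by apply/ssrnat.leP; apply: ratio_weight => //; apply: al_max.
have norm_root (u z : Cx) : u <> Cx0 -> toC z = (toC u) ^- k ->
    Cnorm z = Rinv (pow (Cnorm u) k) /\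
    Rpower (Cnorm z) (Defs.ratio gamma d i0 j0) = pow (Cnorm u) m.
  move=> un0 zE; have nzE : Cnorm z = Rinv (pow (Cnorm u) k).
    by rewrite -CnormX; apply: Cnorm_inv; rewrite zE toCX.
  by split=> //; rewrite nzE Rpower_inv_pow_ratio //; apply: Cnorm_gt0.
have dom (u w : Cx) : (Rr%:C * `|toC u| ^+ m < `|toC w|) <->
    Rlt (Rmult Rr (pow (Cnorm u) m)) (Cnorm w).
  by rewrite !norm_toC -real_complex_pow -rmorphM; apply: real_complex_lt.
have Rr1C : 1 < Rr%:C by rewrite -(rmorph1 (real_complex R)); apply/real_complex_lt.
have sliceC (s : R[i]) : s != 0 -> Rr%:C * `|s| ^+ k < 1 ->
    exists2 mu : R[i], 0 < mu & forall w, Rr%:C * `|s| ^+ m < `|w| ->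
      mu <= `|bieval d N cC (s ^- k) w|.
  rewrite -[s]ofCK; set u := ofC s; rewrite toC_eq0 => /eqP un0 small.
  have [nzE powE] := norm_root u (ofC (toC u ^- k)) un0 (ofCK _).
  have [|mu mu0 lo] := slice (ofC (toC u ^- k)).
    rewrite nzE; move: small; rewrite norm_toC -real_complex_pow -rmorphM.
    rewrite -(rmorph1 (real_complex R)) => /real_complex_lt small.
    have uk0 : Rlt 0 (pow (Cnorm u) k) by apply: pow_lt; apply: Cnorm_gt0.
    apply: (Rmult_lt_reg_r (pow (Cnorm u) k)) => //.
    by rewrite Rinv_l //; lra.
  exists mu%:C; first by apply/real_complex_lt.
  move=> w; rewrite -[w]ofCK => /dom wR.
  have := lo (ofC w); rewrite powE => /(_ wR) muw.
  rewrite -[toC u ^- k]ofCK -toC_poly2 norm_toC.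
  exact/real_complex_le.
have /ssrnat.leP gammaN' := gammaN.
have [cc [t [/gt0_real_complex [c0 c00 ->] /gt0_real_complex [x x0 ->]] H]] :=
  bieval_lower k0 gammaN' (congr1 toC c1) weight Rr1C sliceC.
have xk0 : Rlt 0 (pow x k) by apply: pow_lt.
(* The threshold is chosen so that |z| >= x^-k and z = s^-k force |s| <= x. *)
exists c0, (Rinv (pow x k)) => [|z w zR wR].
  by split=> //; apply: Rinv_0_lt_compat.
have nz0 : Rlt 0 (Cnorm z) by apply: Rlt_le_trans zR; apply: Rinv_0_lt_compat.
have zn0 : toC z != 0 by rewrite -normr_gt0 norm_toC; apply/real_complex_lt.
(* Algebraic closedness supplies s with s^-k = z; any branch would do. *)
pose s := (k.-root (toC z))^-1; pose u := ofC s.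
have sk : s ^- k = toC z by rewrite /s exprVn invrK rootCK.
have sn0 : s != 0.
  by apply: contra_neq zn0 => s0; rewrite -sk s0 expr0n eqn0Ngt k0 invr0.
have uE : toC u = s by exact: ofCK.
have un0 : u <> Cx0 by apply/eqP; rewrite -toC_eq0 uE.
have [nzE powE] : Cnorm z = Rinv (pow (Cnorm u) k) /\
    Rpower (Cnorm z) (Defs.ratio gamma d i0 j0) = pow (Cnorm u) m.
  by apply: norm_root => //; rewrite uE sk.
have ux : Rle (Cnorm u) x.
  case: (Rle_or_lt (Cnorm u) x) => // xu.
  have : Rlt (pow x k) (pow (Cnorm u) k).
    apply/RltP; rewrite !RpowE ltr_pXn2r ?nnegrE //; first exact/RltP.
      by apply/RleP; apply: Rlt_le.
    exact/RleP/Cnorm_ge0.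
  move=> /Rinv_lt_contravar; rewrite -nzE => h.
  have := h (Rmult_lt_0_compat _ _ xk0 (pow_lt _ k (Cnorm_gt0 un0))). lra.
have := H s (toC w) sn0; rewrite sk -uE norm_toC.
move=> /(_ (proj2 (real_complex_le _ _) ux)).
rewrite -norm_toC => /(_ (proj2 (dom u w) _)).
rewrite -powE => /(_ wR).
rewrite -toC_poly2 !norm_toC -!real_complex_pow -!rmorphM => /real_complex_le.
by [].
Qed.

End ComplexNorms.

Import ComplexNorms.

(** * Growth of logarithms along orbits *)

Lemma Cnorm_Cx0 : Cnorm Cx0 = 0.
Proof. unfold Cnorm, Cx0; simpl. rewrite Rmult_0_l, Rplus_0_l. exact sqrt_0. Qed.

Lemma fst_iterf_skew p q n x :
  fst (iterf n (skew p q) x) = iterf n p (fst x).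
Proof. induction n as [|n IH]; simpl; [reflexivity | now rewrite IH]. Qed.

Lemma Rpower_le1 x y : 1 <= x -> y <= 0 -> Rpower x y <= 1.
Proof.
intros Hx Hy. rewrite <- (Rpower_O x) by lra. destruct (Req_dec x 1) as [->|Hn].
- unfold Rpower. rewrite ln_1, !Rmult_0_r. lra.
- apply Rle_Rpower; lra.
Qed.

Lemma ln_nondecreasing x y : 0 < x -> x <= y -> ln x <= ln y.
Proof.
intros Hx [Hy| ->]; [left; now apply ln_increasing | apply Rle_refl].
Qed.

Lemma logplus_le x M : 1 <= M -> 0 <= x <= M -> 0 <= logplus x <= ln M.
Proof.
intros HM [H0 Hx]. unfold logplus. split; [apply Rmax_l|].
assert (L : 0 <= ln M) by (rewrite <- ln_1; apply ln_nondecreasing; lra).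
apply Rmax_lub; [exact L|].
destruct H0 as [H0|<-]; [now apply ln_nondecreasing|].
(* [ln] has the default value 0 at 0, which agrees with the convention log+ 0 = 0. *)
assert (ln0 : ln 0 = 0) by (unfold ln; destruct (Rlt_dec 0 0) as [h|h]; [destruct (Rlt_irrefl 0 h) | reflexivity]).
lra.
Qed.

Lemma bounded_div_pow_cv0 (u : nat -> R) (M b : R) (n0 : nat) :
  1 < b -> (forall n, (n0 <= n)%nat -> 0 <= u n <= M) ->
  Un_cv (fun n => u n / b ^ n) 0.
Proof.
intros Hb Hu eps Heps.
assert (HM : 0 <= M) by (destruct (Hu n0 (le_n _)); lra).
destruct (Pow_x_infinity b (ltac:(rewrite Rabs_right; lra)) (M / eps + 1)) as [n1 Hn1].
exists (max n0 n1). intros n Hn.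
specialize (Hn1 n ltac:(lia)). specialize (Hu n ltac:(lia)).
assert (Hp : 0 < b ^ n) by (apply pow_lt; lra).
rewrite Rabs_right in Hn1 by lra.
unfold Rdist. rewrite Rminus_0_r, Rabs_right.
2:{ apply Rle_ge. unfold Rdiv. apply Rmult_le_pos; [lra|]. left. now apply Rinv_0_lt_compat. }
apply (Rmult_lt_reg_r (b ^ n)); [exact Hp|].
unfold Rdiv. rewrite Rmult_assoc, Rinv_l, Rmult_1_r by lra.
apply Rge_le, (Rmult_le_compat_l eps) in Hn1; [|lra].
replace (eps * (M / eps + 1)) with (M + eps) in Hn1 by (field; lra). nra.
Qed.

(* Both errors are absorbed by shifting: [ln Z - ln 2] and [ln W - C] satisfy the
   recursions without error term because [d >= 2]. *)
Lemma log_growth (Z W : nat -> R) (d gamma : nat) (c0 : R) :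
  (2 <= d)%nat -> (1 <= gamma)%nat -> 0 < c0 ->
  (forall n, 2 < Z n) -> (forall n, 0 < W n) ->
  (forall n, / 2 * Z n ^ d <= Z (S n)) ->
  (forall n, c0 * Z n ^ gamma * W n ^ d <= W (S n)) ->
  exists A kappa, 0 < kappa /\ forall n, INR d ^ n * (A + INR n * kappa) <= ln (W n).
Proof.
intros Hd Hg Hc HZ HW HZS HWS.
assert (Dr : 2 <= INR d) by (replace 2 with (INR 2) by reflexivity; now apply le_INR).
assert (L2 : 0 < ln 2) by (rewrite <- ln_1; apply ln_increasing; lra).
set (k := ln (Z 0%nat) - ln 2).
assert (Hk : 0 < k) by (unfold k; pose proof (ln_increasing 2 (Z 0%nat) ltac:(lra) (HZ 0%nat)); lra).
assert (Hpow : forall n, 0 < INR d ^ n) by (intro; apply pow_lt; lra).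
assert (Y : forall n, INR d ^ n * k <= ln (Z n) - ln 2).
{ induction n as [|n IH]; [simpl; unfold k; lra|].
  pose proof (HZ n) as Hz.
  assert (P : 0 < Z n ^ d) by (apply pow_lt; lra).
  assert (P2 : 0 < / 2 * Z n ^ d) by lra.
  pose proof (ln_nondecreasing _ _ P2 (HZS n)) as H.
  rewrite ln_mult, ln_Rinv, ln_pow in H by lra.
  change (INR d ^ S n) with (INR d * INR d ^ n).
  apply (Rmult_le_compat_l (INR d)) in IH; [|lra]. nra. }
set (C := Rabs (ln c0)).
assert (X : forall n, INR d ^ n * ((ln (W 0%nat) - C) + INR n * (k / INR d)) <= ln (W n) - C).
{ induction n as [|n IH]; [simpl; lra|].
  pose proof (HZ n) as Hz. pose proof (HW n) as Hw.
  assert (P : 0 < Z n ^ gamma) by (apply pow_lt; lra).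
  assert (Q : 0 < W n ^ d) by (apply pow_lt; lra).
  assert (PP : 0 < c0 * Z n ^ gamma) by (now apply Rmult_lt_0_compat).
  pose proof (ln_nondecreasing _ _ (Rmult_lt_0_compat _ _ PP Q) (HWS n)) as H.
  rewrite !ln_mult, !ln_pow in H by assumption || lra.
  assert (HC : - C <= ln c0) by (unfold C; pose proof (Rle_abs (- ln c0)); rewrite Rabs_Ropp in *; lra).
  assert (HC0 : 0 <= C) by apply Rabs_pos.
  specialize (Y n). specialize (Hpow n).
  (* Here gamma >= 1 enters: each step gains at least [INR d ^ n * k], that is k/d after division by
     d^(n+1). *)
  assert (LZ : INR d ^ n * k <= INR gamma * ln (Z n)).
  { assert (1 <= INR gamma) by (replace 1 with (INR 1) by reflexivity; now apply le_INR).
    assert (0 <= ln (Z n)) by (assert (0 < INR d ^ n * k) by nra; lra). nra. }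
  change (INR d ^ S n) with (INR d * INR d ^ n). rewrite S_INR.
  replace (INR d * INR d ^ n * (ln (W 0%nat) - C + (INR n + 1) * (k / INR d)))
    with (INR d * (INR d ^ n * (ln (W 0%nat) - C + INR n * (k / INR d))) + INR d ^ n * k)
    by (field; lra).
  apply (Rmult_le_compat_l (INR d)) in IH; [|lra]. nra. }
exists (ln (W 0%nat) - C), (k / INR d). split; [apply Rdiv_lt_0_compat; lra|].
intro n. specialize (X n). assert (0 <= C) by apply Rabs_pos. lra.
Qed.

(** The delay [n1] costs only the fixed factor b^n1, which the linear term n kappa outweighs. *)
Lemma logplus_growth_cv_infty (W : nat -> R) (b A kappa : R) (n1 : nat) :
  1 < b -> 0 < kappa ->
  (forall n, b ^ n * (A + INR n * kappa) <= ln (W (n1 + n)%nat)) ->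
  cv_infty (fun n => logplus (W n) / b ^ n).
Proof.
intros Hb Hk H M.
assert (B1 : 0 < b ^ n1) by (apply pow_lt; lra).
destruct (INR_unbounded ((M * b ^ n1 - A) / kappa)) as [n2 Hn2].
exists (n1 + n2)%nat. intros n Hn.
replace n with (n1 + (n - n1))%nat by lia.
set (m := (n - n1)%nat). assert (Hm : (n2 <= m)%nat) by (unfold m; lia).
apply le_INR in Hm. specialize (H m).
assert (Bm : 0 < b ^ m) by (apply pow_lt; lra).
assert (G : M * b ^ n1 < A + INR m * kappa).
{ apply (Rmult_lt_compat_r kappa) in Hn2; [|lra].
  replace ((M * b ^ n1 - A) / kappa * kappa) with (M * b ^ n1 - A) in Hn2 by (field; lra).
  nra. }
assert (L : ln (W (n1 + m)%nat) <= logplus (W (n1 + m)%nat)) by apply Rmax_r.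
rewrite pow_add.
apply (Rmult_lt_reg_r (b ^ n1 * b ^ m)); [now apply Rmult_lt_0_compat|].
unfold Rdiv. rewrite Rmult_assoc, Rinv_l, Rmult_1_r by nra.
apply (Rmult_lt_compat_l (b ^ m)) in G; [|lra]. nra.
Qed.

(** * Escape on A_f and boundedness on B_f *)

Section Dynamics.
Variables (d : nat) (a : nat -> Cx) (N gamma : nat) (c : nat -> nat -> Cx).
Variables (alpha : option R) (Rr : R).
Hypothesis Hd : (2 <= d)%nat.
Hypothesis Hp_monic : a d = Cx1.
Hypothesis Hp_deg : forall i, (d < i)%nat -> a i = Cx0.
Hypothesis Hq_supp : forall i j, (N < i \/ d < j)%nat -> c i j = Cx0.
Hypothesis Hb_monic : c gamma d = Cx1.
Hypothesis Hb_deg : forall i, (gamma < i)%nat -> c i d = Cx0.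
Hypothesis Halpha : is_alpha d gamma c alpha.
Hypothesis Halpha0 : alpha_le0 alpha.
Hypothesis HR : 1 < Rr.
Let f := skew (poly1 d a) (poly2 N d c).
Hypothesis HWinv : forall x, W_set alpha Rr x -> W_set alpha Rr (f x).

Lemma gamma_le_N : (gamma <= N)%nat.
Proof.
destruct (Nat.le_gt_cases gamma N) as [H|H]; [exact H|].
rewrite (Hq_supp gamma d (or_introl H)) in Hb_monic.
injection Hb_monic. lra.
Qed.

Lemma W_set_iterf n m x :
  W_set alpha Rr (iterf n f x) -> W_set alpha Rr (iterf (n + m) f x).
Proof.
intro H. induction m as [|m IH]; [now rewrite Nat.add_0_r|].
rewrite Nat.add_succ_r. now apply HWinv.
Qed.

Lemma W_set_snd_pos x : W_set alpha Rr x -> 0 < Cnorm (snd x).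
Proof.
intros [Hz Hw]. destruct alpha as [al|].
- eapply Rlt_trans; [|exact Hw]. apply Rmult_lt_0_compat; [lra|]. apply exp_pos.
- now apply Cnorm_gt0.
Qed.

(** As alpha <= 0 and |z| > 1, |z|^alpha <= 1, so |w| > R would already put the point in W_R. *)
Lemma not_W_set_snd_le x :
  Rr < Cnorm (fst x) -> ~ W_set alpha Rr x -> Cnorm (snd x) <= Rr.
Proof.
intros Hz HW. apply Rnot_lt_le. intro Hw. apply HW. split; [exact Hz|].
destruct alpha as [al|].
- assert (Rpower (Cnorm (fst x)) al <= 1) by (apply Rpower_le1; [lra|exact Halpha0]).
  nra.
- intro H. rewrite H, Cnorm_Cx0 in Hw. lra.
Qed.

(** Finite alpha is the case of [poly2_lower]; for alpha = -infinity, q = b(z) w^d and the bound on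
    the monic b suffices. *)
Lemma fiber_lower : exists c0 R1, 0 < c0 /\ forall z w, R1 <= Cnorm z ->
  W_set alpha Rr (z, w) ->
  c0 * Cnorm z ^ gamma * Cnorm w ^ d <= Cnorm (poly2 N d c z w).
Proof.
destruct alpha as [al|].
- destruct Halpha as [[i0 [j0 [Hj0 [Hc ->]]]] Hmax]. simpl in Halpha0.
  destruct (poly2_lower Hj0 gamma_le_N Hb_monic Hb_deg Halpha0 Hmax HR) as [c0 [R1 [Hc0 HR1] H]].
  + intros z Hz.
    (* Invariance of W_R gives |q(z,w)| > R |p(z)|^alpha, a positive bound independent of w. *)
    exists (Rr * Rpower (Cnorm (poly1 d a z)) (ratio gamma d i0 j0)).
    * apply Rmult_lt_0_compat; [lra|apply exp_pos].
    * intros w Hw. left. apply (HWinv (z, w)). now split.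
  + exists c0, R1. split; [exact Hc0|]. intros z w Hz [_ Hw]. now apply H.
- destruct (monic_poly1_lower (a := fun i => c i d) gamma_le_N Hb_monic Hb_deg)
    as [R1 HR1 H].
  exists (/ 2), R1. split; [lra|]. intros z w Hz _.
  rewrite (poly2_top N z w Halpha), CnormM, CnormX.
  apply Rmult_le_compat_r; [apply pow_le, Cnorm_ge0|]. now apply H.
Qed.

Lemma cv_infty_on_A_f x n0 : (1 <= gamma)%nat ->
  A_p (poly1 d a) (fst x) -> W_set alpha Rr (iterf n0 f x) ->
  cv_infty (fun n => logplus (Cnorm (snd (iterf n f x))) / INR d ^ n).
Proof.
intros Hgamma HA HW.
destruct fiber_lower as [c0 [R1 [Hc0 Hq]]].
destruct (monic_poly1_lower (le_n d) Hp_monic Hp_deg) as [R2 _ Hp].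
(* From time n0 + n1 on, the orbit lies in W_R and |z| exceeds [R1], [R2] and the value 2 required
   by [log_growth]. *)
destruct (HA (Rmax 2 (Rmax R1 R2))) as [n1 Hn1].
pose proof (Rmax_l 2 (Rmax R1 R2)). pose proof (Rmax_r 2 (Rmax R1 R2)).
pose proof (Rmax_l R1 R2). pose proof (Rmax_r R1 R2).
assert (HZ : forall n, Rmax 2 (Rmax R1 R2) < Cnorm (fst (iterf (n0 + n1 + n) f x))).
{ intro n. unfold f. rewrite fst_iterf_skew. apply Hn1. lia. }
assert (HWn : forall n, W_set alpha Rr (iterf (n0 + n1 + n) f x)).
{ intro n. rewrite <- Nat.add_assoc. now apply W_set_iterf. }
destruct (log_growth (fun n => Cnorm (fst (iterf (n0 + n1 + n) f x)))
  (fun n => Cnorm (snd (iterf (n0 + n1 + n) f x))) d gamma c0 Hd Hgamma Hc0)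
  as [A [kappa [Hk HG]]].
- intro n. specialize (HZ n). lra.
- intro n. now apply W_set_snd_pos.
- intro n. rewrite Nat.add_succ_r. simpl. apply Hp. specialize (HZ n). lra.
- intro n. rewrite Nat.add_succ_r. simpl. apply Hq; [specialize (HZ n); lra|].
  rewrite <- surjective_pairing. apply HWn.
- apply (logplus_growth_cv_infty (fun n => Cnorm (snd (iterf n f x))) (INR d) A kappa (n0 + n1));
    [|exact Hk|exact HG].
  replace 1 with (INR 1) by reflexivity. apply lt_INR. lia.
Qed.

Lemma cv_0_on_B_f x : A_p (poly1 d a) (fst x) ->
  (forall n, ~ W_set alpha Rr (iterf n f x)) ->
  Un_cv (fun n => logplus (Cnorm (snd (iterf n f x))) / INR d ^ n) 0.
Proof.
intros HA HB. destruct (HA Rr) as [n0 Hn0].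
apply (bounded_div_pow_cv0 _ (ln Rr) _ n0).
- replace 1 with (INR 1) by reflexivity. apply lt_INR. lia.
- intros n Hn. apply logplus_le; [lra|]. split; [apply Cnorm_ge0|].
  apply not_W_set_snd_le; [|apply HB].
  unfold f. rewrite fst_iterf_skew. now apply Hn0.
Qed.

End Dynamics.

(** A limit in [0, +infinity] is expressed by [cv_infty] for the value +infinity and by [Un_cv] for
    0. *)
Theorem theorem6p7
  (d : nat) (a : nat -> Cx) (N gamma : nat) (c : nat -> nat -> Cx)
  (alpha : option R) (Rr : R)
  (Hd : (2 <= d)%nat)
  (Hp_monic : a d = Cx1) (Hp_deg : forall i, (d < i)%nat -> a i = Cx0)
  (Hq_supp : forall i j, (N < i \/ d < j)%nat -> c i j = Cx0)
  (Hb_monic : c gamma d = Cx1)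
  (Hb_deg : forall i, (gamma < i)%nat -> c i d = Cx0)
  (Hgamma : (1 <= gamma)%nat)
  (Halpha : is_alpha d gamma c alpha)
  (Halpha0 : alpha_le0 alpha)
  (HR : 1 < Rr)
  (HWinv : forall x, W_set alpha Rr x ->
     W_set alpha Rr (skew (poly1 d a) (poly2 N d c) x))
  (HWAp : forall x, W_set alpha Rr x -> A_p (poly1 d a) (fst x)) :
  let f := skew (poly1 d a) (poly2 N d c) in
  let A_f := fun x => exists n, W_set alpha Rr (iterf n f x) in
  let Gseq := fun (x : Cx * Cx) (n : nat) =>
      logplus (Cnorm (snd (iterf n f x))) / (INR d ^ n) in
  (forall x, A_p (poly1 d a) (fst x) -> A_f x -> cv_infty (Gseq x)) /\
  (forall x, A_p (poly1 d a) (fst x) -> ~ A_f x -> Un_cv (Gseq x) 0).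
Proof.
intros f A_f Gseq. split.
- intros x HA [n0 HW]. now apply (cv_infty_on_A_f d a N gamma c alpha Rr) with n0.
- intros x HA HB. apply (cv_0_on_B_f d a N gamma c alpha Rr); try assumption.
  intros n HW. apply HB. now exists n.
Qed.
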